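(* A $*$-distribution $\mu\in\mathcal D(l,r,* )$ is $\eta$-diagonal if and only if both of the following hold: (i) $\mu(Z_w)=0$ whenever $w\in\mathcal W^+$ is not mixed alternating; (ii) for every mixed alternating word $w\in\mathcal W^+$ with canonical factorization $w_{\chi_w}=w_1\cdots w_d$, one has $$\mu(Z_w)=\mu(Z_{w|_{J_1}})\cdots\mu(Z_{w|_{J_d}}),$$ where $\pi_w=\{J_1,\dots,J_d\}\in BI(\chi_w)$ is the bi-interval partition such that $w_{\chi_w}|_{J_i}=w_i$ for $i=1,\dots,d$.
   Context: Let $\mathcal W^+=\bigsqcup_{n\ge1}\{l,l^*,r,r^*\}^n$ be the set of non-empty words over $\{l,l^*,r,r^*\}$. $\mathcal D(l,r,* )$ is the set of unital linear functionals $\mu:\mathbb C\langle Z_l,Z_l^*,Z_r,Z_r^*\rangle\to\mathbb C$ on the algebra of non-commutative polynomials. For $w=w_1\cdots w_n\in\mathcal W^+$, $Z_w=Z_{w_1}\cdots Z_{w_n}$ (with $Z_{l^*}=Z_l^*$, $Z_{r^*}=Z_r^*$) in $\mu(Z_w)$, while in cumulants $Z_w$ denotes the tuple $(Z_{w_1},\dots,Z_{w_n})$. For $J=\{i_1<\dots<i_m\}$, $w|_J=w_{i_1}\cdots w_{i_m}$. $\chi_w:\{1,\dots,n\}\to\{l,r\}$ is $\chi_w(k)=l$ if $w_k\in\{l,l^*\}$ and $\chi_w(k)=r$ if $w_k\in\{r,r^*\}$. For $\chi:\{1,\dots,n\}\to\{l,r\}$, the permutation $s_\chi$ is defined by $\chi^{-1}(\{l\})=\{s_\chi(1)<\cdots<s_\chi(k)\}$,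 $\chi^{-1}(\{r\})=\{s_\chi(k+1)>\cdots>s_\chi(n)\}$; it gives the order $s_\chi(1)\prec_\chi\cdots\prec_\chi s_\chi(n)$. $BI(\chi)$ is the set of partitions of $\{1,\dots,n\}$ all of whose blocks are intervals for $\prec_\chi$. The bi-Boolean cumulants of $\mu$ are the multilinear functionals $B_\chi$ determined recursively by $\mu(a_1\cdots a_n)=\sum_{\pi\in BI(\chi)}\prod_{V\in\pi}B_{\chi|_V}((a_1,\dots,a_n)|_V)$, with entries of $V$ taken in increasing natural order and $\chi|_V$ relabelled order-preservingly. Write $w_{\chi_w}=w_{s_{\chi_w}(1)}\cdots w_{s_{\chi_w}(n)}$. Let $W_1$ (resp. $W_2$) be the set of words $l^{\omega(1)}\cdots l^{\omega(k)}r^{\omega(k+1)}\cdots r^{\omega(2m)}$ with $m\ge1$, $0\le k\le2m$, $\omega:\{1,\dots,2m\}\to\{1,*\}$, $\omega(i)\ne\omega(i+1)$ for all $i$, and $\omega(1)=1$ (resp. $\omega(1)=*$). A word $w\in\mathcal W^+$ is alternating if $w_{\chi_w}\in W_1\cup W_2$. It is mixed alternating if $w_{\chi_w}=w_1\cdots w_p$ (concatenation, $p\ge1$) with $w_i\in W_{j_i}$, $j_i\in\{1,2\}$, $j_1\ne j_2\ne\cdots\ne j_p$ (consecutive indices distinct); this (unique) factorization is the canonical factorization. The associated partition $\pi_w=\{J_1,\dots,J_p\}$ is given by $J_i=\{s_{\chi_w}(t):|w_1|+\cdots+|w_{i-1}|<t\le|w_1|+\cdots+|w_i|\}$. $\mu\in\mathcal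 D(l,r,* )$ is $\eta$-diagonal if $B_{\chi_w}(Z_w)=0$ whenever $w\in\mathcal W^+$ is not alternating. *)

(* Defs.v *)
From HB Require Import structures.
From mathcomp Require Import all_boot all_order all_algebra.
From mathcomp Require Import reals complex monalg.

Set Implicit Arguments.
Unset Strict Implicit.
Unset Printing Implicit Defensive.

Import GRing.Theory.
Local Open Scope ring_scope.

Inductive face := lface | rface.


Definition face_to_bool (x : face) : bool := if x is lface then false else true.
Definition bool_to_face (b : bool) : face := if b then rface else lface.
Lemma face_to_boolK : cancel face_to_bool bool_to_face.
Proof. by case. Qed.

HB.instance Definition _ := Countable.copy face (can_type face_to_boolK).

(* (lface, false), (lface, true), (rface, false), (rface, true) stand for
   l, l*, r, r*: the boolean says whether the letter carries a star. *)
Notation letter := (face * bool)%type.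
Notation word := (seq letter).

(* The unital algebra C<Z_l, Z_l*, Z_r, Z_r*>, as the monoid algebra over the
   complex numbers of the free monoid on the four letters. *)
Notation ncpoly R := {malg (complex R)[{fmonom letter}]}.

Section Generators.
Variable R : realType.

Definition Zgen (x : letter) : ncpoly R := << fmu x >>.
Definition Zword (w : word) : ncpoly R := \prod_(x <- w) Zgen x.

End Generators.

Section ChiOrder.
Variables (n : nat) (chi : 'I_n -> face).

(* The sequence s_chi(1), ..., s_chi(n). *)
Definition s_chi : seq 'I_n :=
  [seq i <- enum 'I_n | chi i == lface]
    ++ rev [seq i <- enum 'I_n | chi i == rface].

(* Zero-based position for the order prec_chi: chi_rank (s_chi(t+1)) = t. *)
Definition chi_rank (i : 'I_n) : nat := index i s_chi.

Definition chi_interval (V : {set 'I_n}) : bool :=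
  [forall i in V, forall k in V, forall j,
    (chi_rank i <= chi_rank j <= chi_rank k)%N ==> (j \in V)].

Definition BI : {set {set {set 'I_n}}} :=
  [set P | partition P [set: 'I_n] & [forall V in P, chi_interval V]].

End ChiOrder.

(* enum_val : 'I_#|V| -> 'I_n is the increasing enumeration of V. *)
Definition restr n T (V : {set 'I_n}) (f : 'I_n -> T) : 'I_#|V| -> T :=
  fun i => f (enum_val i).
Arguments restr {n T} V f.

Section Cumulants.
Variables (C : comNzRingType) (A : nzRingType) (mu : A -> C).

(* The moment-cumulant relation, solved for the term of the one-block
   partition.  The first argument bounds the depth of the recursion; see
   moment_bcumulant and bcumulant_unique below. *)
Fixpoint bcumulant_rec (k n : nat) (chi : 'I_n -> face) (a : 'I_n -> A) : C :=
  if k is k'.+1 then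
    mu (\prod_(i < n) a i)
    - \sum_(P in BI chi | P != [set setT])
        \prod_(V in P) bcumulant_rec k' (restr V chi) (restr V a)
  else 0.

Definition bcumulant (n : nat) (chi : 'I_n -> face) (a : 'I_n -> A) : C :=
  bcumulant_rec n chi a.

Lemma eq_chi_rank n (chi chi' : 'I_n -> face) :
  chi =1 chi' -> chi_rank chi =1 chi_rank chi'.
Proof.
move=> e i; rewrite /chi_rank /s_chi; congr (index i (_ ++ rev _));
  by apply: eq_filter => j; rewrite e.
Qed.

Lemma eq_BI n (chi chi' : 'I_n -> face) : chi =1 chi' -> BI chi = BI chi'.
Proof.
move=> e; apply/setP => P; rewrite !inE; congr (_ && _).
apply: eq_forallb => V; congr (_ ==> _).
apply: eq_forallb => i; congr (_ ==> _); apply: eq_forallb => k.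
by congr (_ ==> _); apply: eq_forallb => j; rewrite !(eq_chi_rank e).
Qed.

Lemma eq_bcumulant_rec k n (chi chi' : 'I_n -> face) (a a' : 'I_n -> A) :
  chi =1 chi' -> a =1 a' -> bcumulant_rec k chi a = bcumulant_rec k chi' a'.
Proof.
elim: k n chi chi' a a' => [//|k IH] n chi chi' a a' ec ea /=.
congr (mu _ - _); first by apply: eq_bigr.
rewrite (eq_BI ec); apply: eq_bigr => P _; apply: eq_bigr => V _.
by apply: IH => i; rewrite /restr.
Qed.

Lemma BI_block_lt n (chi : 'I_n -> face) P V :
  P \in BI chi -> P != [set setT] -> V \in P -> (#|V| < n)%N.
Proof.
rewrite inE => /andP[partP _] neq VP.
rewrite ltn_neqAle -[X in (_ <= X)%N]card_ord max_card andbT.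
apply: contraNneq neq => cardV.
have VT : V = setT.
  by apply/eqP; rewrite eqEcard subsetT cardsT card_ord cardV /=.
have [/eqP _ /trivIsetP triv n0] := and3P partP.
apply/eqP/setP => W; rewrite inE -VT; apply/idP/eqP => [WP|->//].
apply/eqP; apply: contraT => neqWV.
have := triv _ _ WP VP neqWV; rewrite VT -setI_eq0 setIT => /eqP W0.
by rewrite W0 (negbTE n0) in WP.
Qed.

Lemma bcumulant_rec_ge k n (chi : 'I_n -> face) (a : 'I_n -> A) :
  (0 < n <= k)%N -> bcumulant_rec k chi a = bcumulant chi a.
Proof.
move=> nk.
suff H : forall j k m (ch : 'I_m -> face) (b : 'I_m -> A),
    (0 < m <= j)%N -> (m <= k)%N -> bcumulant_rec j ch b = bcumulant_rec k ch b.
  by apply: H => //.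
move=> {k n chi a nk} j; elim: j => [|j IH] [|k] m ch b; try by case: m ch b.
move=> /andP[m0 mj] mk /=; congr (_ - _).
apply: eq_bigr => P /andP[PB neq]; apply: eq_bigr => V VP.
have lt := BI_block_lt PB neq VP; apply: IH; last by rewrite -ltnS (leq_trans lt).
rewrite -[X in _ && X]ltnS (leq_trans lt) // andbT card_gt0.
move: PB; rewrite inE => /andP[/and3P[_ _ n0] _].
by apply: contraNneq n0 => <-.
Qed.

Lemma setT_BI n (chi : 'I_n -> face) : (0 < n)%N -> [set setT] \in BI chi.
Proof.
move=> n0; rewrite inE; apply/andP; split; last first.
  by apply/forallP => V; apply/implyP; rewrite inE => /eqP ->;
     apply/forallP => i; apply/implyP => _; apply/forallP => k;
     apply/implyP => _; apply/forallP => j; rewrite inE implybT.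
apply/and3P; split; first by rewrite /cover big_set1.
  by apply/trivIsetP => U V; rewrite !inE => /eqP-> /eqP->; rewrite eqxx.
rewrite inE eq_sym; apply/set0Pn; exists (Ordinal n0); exact: in_setT.
Qed.

Lemma enum_val_setT n (i : 'I_#|[set: 'I_n]|) : nat_of_ord (enum_val i) = i.
Proof.
have lt : (i < n)%N by apply: leq_trans (ltn_ord i) _; rewrite cardsT card_ord.
rewrite (enum_val_nth (Ordinal lt)) enum_setT -enumT.
by rewrite nth_enum_ord.
Qed.

Lemma restr_setT (B : forall n, ('I_n -> face) -> ('I_n -> A) -> C) :
  (forall n (chi chi' : 'I_n -> face) (a a' : 'I_n -> A),
     chi =1 chi' -> a =1 a' -> B n chi a = B n chi' a') ->
  forall n (chi : 'I_n -> face) (a : 'I_n -> A),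
    B _ (restr setT chi) (restr setT a) = B n chi a.
Proof.
move=> Bext n chi a.
have : forall m (f : 'I_m -> 'I_n), m = n -> (forall i, nat_of_ord (f i) = i) ->
    B m (chi \o f) (a \o f) = B n chi a.
  move=> m f emn; subst m => fE.
  by apply: Bext => i; rewrite /=; congr (_ _); apply: val_inj; rewrite /= fE.
apply; [by rewrite cardsT card_ord | exact: enum_val_setT].
Qed.

Lemma moment_bcumulant n (chi : 'I_n -> face) (a : 'I_n -> A) : (0 < n)%N ->
  mu (\prod_(i < n) a i) =
  \sum_(P in BI chi) \prod_(V in P) bcumulant (restr V chi) (restr V a).
Proof.
move=> n0; rewrite (bigD1 [set setT]) ?setT_BI //= big_set1.
rewrite (@restr_setT (fun n => @bcumulant n)); last first.
  by move=> *; apply: eq_bcumulant_rec.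
rewrite {1}/bcumulant; case: n n0 chi a => [//|n] _ chi a /=.
rewrite -[LHS](subrK (\sum_(P in BI chi | P != [set setT])
  \prod_(V in P) bcumulant_rec n (restr V chi) (restr V a))); congr (_ + _).
apply: eq_bigr => P /andP[PB neq]; apply: eq_bigr => V VP.
apply: bcumulant_rec_ge; rewrite -[X in _ && X]ltnS (BI_block_lt PB neq VP).
rewrite andbT card_gt0; move: PB; rewrite inE => /andP[/and3P[_ _ n1] _].
by apply: contraNneq n1 => <-.
Qed.

Lemma bcumulant_unique (B : forall n, ('I_n -> face) -> ('I_n -> A) -> C) :
  (forall n (chi chi' : 'I_n -> face) (a a' : 'I_n -> A),
     chi =1 chi' -> a =1 a' -> B n chi a = B n chi' a') ->
  (forall n (chi : 'I_n -> face) (a : 'I_n -> A), (0 < n)%N ->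
     mu (\prod_(i < n) a i) =
     \sum_(P in BI chi) \prod_(V in P) B _ (restr V chi) (restr V a)) ->
  forall n (chi : 'I_n -> face) (a : 'I_n -> A), (0 < n)%N ->
    B n chi a = bcumulant chi a.
Proof.
move=> Bext BE n; elim/ltn_ind: n => n IH chi a n0.
have := BE n chi a n0; rewrite (moment_bcumulant chi a n0).
rewrite (bigD1 [set setT]) ?setT_BI //= [RHS](bigD1 [set setT]) ?setT_BI //=.
rewrite !big_set1 (restr_setT Bext) (@restr_setT (fun n => @bcumulant n)).
  rewrite (eq_bigr (fun P : {set {set 'I_n}} =>
    \prod_(V in P) B _ (restr V chi) (restr V a))); first by move/addIr.
  move=> P /andP[PB neq]; apply: eq_bigr => V VP; rewrite IH //.
    exact: BI_block_lt PB neq VP.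
  rewrite card_gt0; move: PB; rewrite inE => /andP[/and3P[_ _ n1] _].
  by apply: contraNneq n1 => <-.
by move=> *; apply: eq_bcumulant_rec.
Qed.

End Cumulants.

Definition chi_word (w : word) : 'I_(size w) -> face :=
  fun i => (tnth (in_tuple w) i).1.
Arguments chi_word w : clear implicits.

(* w_{chi_w} *)
Definition chi_arrange (w : word) : word :=
  [seq tnth (in_tuple w) i | i <- s_chi (chi_word w)].

Definition word_restr (w : word) (J : {set 'I_(size w)}) : word :=
  [seq tnth (in_tuple w) i | i <- enum J].
Arguments word_restr w J : clear implicits.

(* W_1 is Wset false and W_2 is Wset true. *)
Definition Wset (e : bool) (u : word) : Prop :=
  exists (m k : nat) (omega : (2 * m).-tuple bool),
    [/\ (1 <= m)%N, (k <= 2 * m)%N, ohead omega = Some e,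
        sorted (fun s t => s != t) omega
      & u = [seq (lface, s) | s <- take k omega]
              ++ [seq (rface, s) | s <- drop k omega]].

Definition alternating (w : word) : Prop :=
  Wset false (chi_arrange w) \/ Wset true (chi_arrange w).

Definition canonical_factorization (w : word) (us : seq word) : Prop :=
  [/\ (1 <= size us)%N, chi_arrange w = flatten us
    & exists js : seq bool,
        [/\ size js = size us,
            forall i, (i < size us)%N -> Wset (nth false js i) (nth [::] us i)
          & sorted (fun j j' => j != j') js]].

Definition mixed_alternating (w : word) : Prop :=
  exists us, canonical_factorization w us.

(* The block J_{i+1} of pi_w; us is the canonical factorization of w. *)
Definition factor_block (w : word) (us : seq word) (i : nat)
    : {set 'I_(size w)} :=
  let start := (\sum_(j < i) size (nth [::] us j))%N in
  [set x | (start <= chi_rank (chi_word w) x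
              < start + size (nth [::] us i))%N].

Definition bcumulant_word (R : realType) (mu : {scalar ncpoly R}) (w : word)
    : complex R :=
  bcumulant mu (chi_word w) (fun i => Zgen R (tnth (in_tuple w) i)).

Definition eta_diagonal (R : realType) (mu : {scalar ncpoly R}) : Prop :=
  forall w : word, w != [::] -> ~ alternating w -> bcumulant_word mu w = 0.

(* Main.v *)
Require Import Defs.
From mathcomp Require Import all_boot all_order all_algebra.
From mathcomp Require Import reals complex monalg zify.

(* Reading a word w in the order of chi_w, bi-interval partitions become
   interval partitions, so splitting off the first block gives the Boolean
   recursion  M w = sum_(0 < k <= n) B (w[0,k[) * M (w[k,n[)  (moment_word_rec).
   A word is alternating iff its length is even and no two consecutive letters
   (in the order of chi_w) carry the same star.  The theorem goes through a third
   condition, factorizing: odd moments vanish, and M w = M (w[0,c[) * M (w[c,n[)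
   as soon as the letters c-1 and c carry the same star.  By the recursion this is
   equivalent to eta-diagonality, since no alternating block crosses such a cut c;
   and it is equivalent to (i) and (ii) because the cuts of a mixed alternating
   word are exactly the boundaries of its canonical factorization. *)

Set Implicit Arguments.
Unset Strict Implicit.
Unset Printing Implicit Defensive.

Import GRing.Theory.
Local Open Scope ring_scope.

(** * Segments of a word in the chi-order *)

Section ChiOrderTheory.
Variables (n : nat) (chi : 'I_n -> face).

Lemma mem_s_chi i : i \in s_chi chi.
Proof.
by rewrite mem_cat mem_rev mem_filter mem_enum mem_filter mem_enum; case: (chi i).
Qed.

Lemma uniq_s_chi : uniq (s_chi chi).
Proof.
rewrite cat_uniq rev_uniq !(filter_uniq _ (enum_uniq _)) andbT /=.
apply/hasPn => i; rewrite mem_rev mem_filter => /andP[/eqP ri _].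
by rewrite mem_filter ri.
Qed.

Lemma size_s_chi : size (s_chi chi) = n.
Proof.
rewrite -[RHS]card_ord -(card_uniqP uniq_s_chi).
by apply: eq_card => i; rewrite mem_s_chi.
Qed.

Lemma chi_rank_lt i : (chi_rank chi i < n)%N.
Proof. by rewrite /chi_rank -[X in (_ < X)%N]size_s_chi index_mem mem_s_chi. Qed.

Lemma chi_rank_nth x0 k : (k < n)%N -> chi_rank chi (nth x0 (s_chi chi) k) = k.
Proof. by move=> kn; rewrite /chi_rank index_uniq ?size_s_chi ?uniq_s_chi. Qed.

Lemma chi_rank_surj k : (k < n)%N -> {i | chi_rank chi i = k}.
Proof.
by move=> kn; exists (nth (Ordinal kn) (s_chi chi) k); apply: chi_rank_nth.
Qed.

(** Half-open, so that adjacent segments share their endpoint; every [factor_block] is such a set by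
    conversion. *)
Definition rank_seg a b : {set 'I_n} := [set i | (a <= chi_rank chi i < b)%N].

Lemma in_rank_seg a b i : (i \in rank_seg a b) = (a <= chi_rank chi i < b)%N.
Proof. by rewrite inE. Qed.

Lemma rank_seg_full : rank_seg 0 n = setT.
Proof. by apply/setP => i; rewrite !inE chi_rank_lt. Qed.

Lemma filter_rank_seg a b :
  [seq i <- s_chi chi | i \in rank_seg a b] = take (b - a) (drop a (s_chi chi)).
Proof.
(* With ranks written as indices in the list, the claim holds for every duplicate-free list and goes
   by induction on it. *)
have -> : [seq i <- s_chi chi | i \in rank_seg a b] =
          [seq i <- s_chi chi | (a <= index i (s_chi chi) < b)%N].
  by apply: eq_filter => i; rewrite in_rank_seg.
have := uniq_s_chi; move: (s_chi chi) => s; elim: s a b => [|x s IH] a b //=.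
case/andP => xs us; rewrite eqxx.
have E a' b' : [seq i <- s | (a'.+1 <= index i (x :: s) < b'.+1)%N] =
             [seq i <- s | (a' <= index i s < b')%N].
  by apply: eq_in_filter => i i_s /=; case: eqP => // xi; rewrite xi i_s in xs.
case: b => [|b]; last case: a => [|a].
- rewrite ltn0 andbF sub0n take0 (eq_filter (a2 := pred0)) ?filter_pred0 // => i.
  by rewrite ltn0 andbF.
- rewrite /=; congr (_ :: _); have := IH 0 b us; rewrite subn0 drop0 => <-.
  apply: eq_in_filter => i i_s /=.
  by case: eqP => // xi; rewrite xi i_s in xs.
by rewrite /= subSS -IH // -E.
Qed.

Lemma chi_intervalP (V : {set 'I_n}) :
  reflect (forall i k j, i \in V -> k \in V ->
             (chi_rank chi i <= chi_rank chi j <= chi_rank chi k)%N -> j \in V)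
          (chi_interval chi V).
Proof.
apply: (iffP forall_inP) => [H i k j iV kV ij|H i iV].
  by have /forall_inP/(_ k kV)/forallP/(_ j)/implyP := H i iV; apply.
by apply/forall_inP => k kV; apply/forallP => j; apply/implyP; apply: H.
Qed.

Lemma chi_interval_rank_seg a b : chi_interval chi (rank_seg a b).
Proof. by apply/chi_intervalP => i k j; rewrite !in_rank_seg; lia. Qed.

End ChiOrderTheory.

(** * Restriction of a word to a set of positions *)

Section Restriction.
Variables (w : word) (J : {set 'I_(size w)}).

Lemma size_word_restr : size (word_restr w J) = #|J|.
Proof. by rewrite size_map -cardE. Qed.

(** The cast is there because the length of the restricted word and [#|J|] are equal only by a
    proof. *)
Definition restr_emb (i : 'I_(size (word_restr w J))) : 'I_(size w) :=
  enum_val (cast_ord size_word_restr i).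

Lemma restr_emb_inj : injective restr_emb.
Proof. by move=> i j /enum_val_inj/cast_ord_inj. Qed.

Lemma tnth_restr_emb i :
  tnth (in_tuple (word_restr w J)) i = tnth (in_tuple w) (restr_emb i).
Proof.
rewrite (tnth_nth (lface, false)) /= (nth_map (restr_emb i)).
  by rewrite {2}/restr_emb (enum_val_nth (restr_emb i)).
by rewrite -cardE -size_word_restr.
Qed.

Lemma map_restr_emb : [seq restr_emb i | i : 'I_(size (word_restr w J))] = enum J.
Proof.
have sz : size [seq restr_emb i | i : 'I_(size (word_restr w J))] = size (enum J).
  by rewrite size_map size_enum_ord size_word_restr cardE.
case E: (enum J) => [|x0 s]; first by apply/size0nil; rewrite sz E.
rewrite -E; apply: (@eq_from_nth _ x0) => // i; rewrite size_map size_enum_ord => lti.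
rewrite (nth_map (Ordinal lti)) ?size_enum_ord // /restr_emb (enum_val_nth x0) /=.
by rewrite nth_enum_ord.
Qed.

Lemma filter_enum_set n (A : {set 'I_n}) : [seq i <- enum 'I_n | i \in A] = enum A.
Proof. by rewrite {1}enumT [RHS]/enum_mem. Qed.

Lemma map_restr_emb_filter (p : pred 'I_(size w)) :
  [seq restr_emb i | i <- enum 'I_(size (word_restr w J)) & p (restr_emb i)] =
  [seq i <- [seq i <- enum 'I_(size w) | p i] | i \in J].
Proof.
transitivity [seq i <- enum J | p i].
  by rewrite -map_restr_emb [RHS]filter_map.
rewrite -filter_enum_set -!(filter_predI _ _ (enum _)).
by apply: eq_filter => i /=; rewrite andbC.
Qed.

Lemma imset_restr_emb : restr_emb @: setT = J.
Proof.
apply/setP => i; rewrite -[RHS]mem_enum -map_restr_emb.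
by apply/imsetP/mapP => -[j _ ->]; exists j; rewrite ?mem_enum.
Qed.

Lemma restr_embP i : restr_emb i \in J.
Proof. by have := imset_f restr_emb (in_setT i); rewrite imset_restr_emb. Qed.

Lemma restr_emb_surj i : i \in J -> exists j, i = restr_emb j.
Proof.
 by rewrite -{1}imset_restr_emb => /imsetP[j _ ->]; exists j.
Qed.

Lemma chi_word_restr i : chi_word (word_restr w J) i = chi_word w (restr_emb i).
Proof. by rewrite /chi_word tnth_restr_emb. Qed.

(** The embedding is increasing and keeps the side of each letter, so it carries the chi-order of
    the restricted word to the order induced from [w]. *)
Lemma map_restr_emb_s_chi :
  [seq restr_emb i | i <- s_chi (chi_word (word_restr w J))] =
  [seq i <- s_chi (chi_word w) | i \in J].
Proof.
have E x : [seq restr_emb i | i <- enum 'I_(size (word_restr w J))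
                                 & chi_word (word_restr w J) i == x] =
           [seq i <- [seq i <- enum 'I_(size w) | chi_word w i == x] | i \in J].
  rewrite -(map_restr_emb_filter (fun i => chi_word w i == x)).
  by congr (map _ _); apply: eq_filter => i; rewrite chi_word_restr.
by rewrite /s_chi map_cat map_rev !E filter_cat filter_rev.
Qed.

Lemma chi_arrange_restr :
  chi_arrange (word_restr w J) =
  [seq tnth (in_tuple w) i | i <- s_chi (chi_word w) & i \in J].
Proof.
by rewrite -map_restr_emb_s_chi -map_comp; apply: eq_map => i; exact: tnth_restr_emb.
Qed.

Lemma word_restr_restr (V : {set 'I_(size (word_restr w J))}) :
  word_restr (word_restr w J) V = word_restr w (restr_emb @: V).
Proof.
rewrite /word_restr (eq_map tnth_restr_emb) (map_comp (tnth (in_tuple w))).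
congr (map _ _); rewrite -filter_enum_set.
(* Membership in [V] becomes membership in its image, the form to which [map_restr_emb_filter]
   applies. *)
rewrite (eq_filter (a2 := fun i => restr_emb i \in restr_emb @: V)).
  rewrite map_restr_emb_filter filter_enum_set; apply/all_filterP/allP => i.
  by rewrite mem_enum => /imsetP[j _ ->]; exact: restr_embP.
by move=> i; rewrite mem_imset //; exact: restr_emb_inj.
Qed.

End Restriction.

Lemma size_chi_arrange w : size (chi_arrange w) = size w.
Proof. by rewrite size_map size_s_chi. Qed.

Lemma word_restrT w : word_restr w setT = w.
Proof.
by rewrite /word_restr enum_setT -enumT map_tnth_enum.
Qed.

(** * Subwords on consecutive ranks *)

Definition word_seg (w : word) a b : word :=
  word_restr w (rank_seg (chi_word w) a b).

Section Segments.
Implicit Types (w : word) (a b c d : nat).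

Lemma chi_arrange_seg w a b :
  chi_arrange (word_seg w a b) = take (b - a) (drop a (chi_arrange w)).
Proof. by rewrite chi_arrange_restr filter_rank_seg map_take map_drop. Qed.

Lemma size_seg w a b : (b <= size w)%N -> size (word_seg w a b) = (b - a)%N.
Proof.
move=> bw; rewrite -size_chi_arrange chi_arrange_seg size_take_min size_drop.
rewrite size_chi_arrange; lia.
Qed.

Lemma word_seg_full w : word_seg w 0 (size w) = w.
Proof. by rewrite /word_seg rank_seg_full word_restrT. Qed.

(** The chi-order of the segment is the slice of the chi-order of [w] that starts at [a]. *)
Lemma chi_rank_seg w a b (i : 'I_(size (word_seg w a b))) :
  chi_rank (chi_word w) (restr_emb i) = (a + chi_rank (chi_word (word_seg w a b)) i)%N.
Proof.
set s := s_chi (chi_word (word_seg w a b)); set r := chi_rank _ i.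
have lt_r : (r < size s)%N by rewrite index_mem mem_s_chi.
have E : map (@restr_emb w _) s = take (b - a) (drop a (s_chi (chi_word w))).
  by rewrite map_restr_emb_s_chi filter_rank_seg.
have lt_r' : (r < size (take (b - a) (drop a (s_chi (chi_word w)))))%N.
  by rewrite -E size_map.
have szs := size_s_chi (chi_word w).
have lt_ar : (a + r < size w)%N.
  by move: lt_r'; rewrite size_take_min size_drop szs; lia.
rewrite -[RHS](chi_rank_nth (chi_word w) (restr_emb i) lt_ar); congr chi_rank.
rewrite -nth_drop -(nth_take _ (n0 := (b - a)%N)) -?E.
  by rewrite (nth_map i) // nth_index // mem_s_chi.
by move: lt_r'; rewrite size_take_min; lia.
Qed.

Lemma restr_emb_rank_seg w a b c d : (a + d <= b)%N ->
  @restr_emb w (rank_seg (chi_word w) a b)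
    @: rank_seg (chi_word (word_seg w a b)) c d =
  rank_seg (chi_word w) (a + c)%N (a + d)%N.
Proof.
move=> adb; apply/setP => i; rewrite in_rank_seg; apply/imsetP/idP.
  by case=> j; rewrite in_rank_seg => jcd ->; rewrite chi_rank_seg leq_add2l ltn_add2l.
move=> icd; have /restr_emb_surj[j ij] : i \in rank_seg (chi_word w) a b.
  by rewrite in_rank_seg; lia.
by exists j => //; move: icd; rewrite in_rank_seg ij chi_rank_seg leq_add2l ltn_add2l.
Qed.

Lemma word_seg_seg w a b c d : (a + d <= b)%N ->
  word_seg (word_seg w a b) c d = word_seg w (a + c)%N (a + d)%N.
Proof.
by move=> adb; rewrite {1}/word_seg word_restr_restr restr_emb_rank_seg.
Qed.

End Segments.

(** * The Boolean moment-cumulant recursion *)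

Section Moments.
Variables (R : realType) (mu : {scalar ncpoly R}).
Hypothesis mu1 : mu 1 = 1.

Local Notation M w := (mu (Zword R w)).
Local Notation B w := (bcumulant_word mu w).

Lemma bcumulant_word_restr w (V : {set 'I_(size w)}) :
  B (word_restr w V) =
  bcumulant mu (restr V (chi_word w)) (restr V (fun i => Zgen R (tnth (in_tuple w) i))).
Proof.
rewrite /bcumulant_word.
(* The two cumulants have index types of provably equal size; destructing the equality identifies
   them. *)
have cast m n (e : m = n) (chi : 'I_n -> face) (a : 'I_n -> ncpoly R) :
    bcumulant mu (chi \o cast_ord e) (a \o cast_ord e) = bcumulant mu chi a.
  by case: n / e chi a => chi a; apply: eq_bcumulant_rec => i; rewrite /= cast_ord_id.
rewrite -(cast _ _ (size_word_restr V)).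
apply: eq_bcumulant_rec => i /=; rewrite /restr -/(restr_emb i).
  exact: chi_word_restr.
by rewrite tnth_restr_emb.
Qed.

Lemma moment_word_nil : M [::] = 1.
Proof. by rewrite /Zword big_nil. Qed.

Lemma moment_word w :
  M w = \sum_(P in BI (chi_word w)) \prod_(V in P) B (word_restr w V).
Proof.
(* The moment-cumulant relation is stated for positive length; for the empty word the only partition
   is empty and both sides are 1. *)
case: (posnP (size w)) => [/size0nil -> {w}|n0].
  rewrite moment_word_nil (big_pred1 set0) ?big_set0 // => P.
  have T0 : [set: 'I_0] = set0 by apply/setP => -[].
  rewrite /= inE T0 partition_set0 andb_idr // => /eqP->.
  by apply/forall_inP => V; rewrite inE.
rewrite /Zword big_tnth (moment_bcumulant _ (chi_word w)) //.
apply: eq_bigr => P _; apply: eq_bigr => V _.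
by rewrite bcumulant_word_restr.
Qed.

(** Ranks shift by a constant, and any letter ranked between two letters of the segment lies in the
    segment. *)
Lemma chi_interval_seg w a b (V : {set 'I_(size (word_seg w a b))}) :
  chi_interval (chi_word w) (@restr_emb w _ @: V) =
  chi_interval (chi_word (word_seg w a b)) V.
Proof.
apply/chi_intervalP/chi_intervalP => H i k j.
  move=> iV kV ij; rewrite -(mem_imset _ _ (@restr_emb_inj w _)).
  by apply: (H _ _ _ (imset_f _ iV) (imset_f _ kV)); rewrite !chi_rank_seg !leq_add2l.
case/imsetP=> i' iV -> /imsetP[k' kV ->] ij.
have /restr_emb_surj[j' jj] : j \in rank_seg (chi_word w) a b.
  have := restr_embP i'; have := restr_embP k'; rewrite !in_rank_seg; lia.
rewrite jj in ij *; apply: imset_f; apply: (H _ _ _ iV kV).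
by move: ij; rewrite !chi_rank_seg !leq_add2l.
Qed.

(** The block containing the letter of rank 0 is an interval, hence a prefix, and [k0] is the rank
    of its last letter; disjointness of blocks rules out any other prefix. *)
Lemma BI_first_block w P : (0 < size w)%N -> P \in BI (chi_word w) ->
  exists k0 : 'I_(size w),
    forall k : 'I_(size w), (rank_seg (chi_word w) 0 k.+1 \in P) = (k == k0).
Proof.
move=> n0; rewrite inE => /andP[partP /forall_inP intP].
have [/eqP covP trivP _] := and3P partP.
have [x0 rx0] := chi_rank_surj (chi_word w) n0.
have x0P : x0 \in cover P by rewrite covP inE.
have x0V : x0 \in pblock P x0 by rewrite mem_pblock.
have VP : pblock P x0 \in P by rewrite pblock_mem.
case: (arg_maxnP (fun i => chi_rank (chi_word w) i) x0V) => m mV maxm.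
have VE : pblock P x0 = rank_seg (chi_word w) 0 (chi_rank (chi_word w) m).+1.
  apply/setP => i; rewrite in_rank_seg ltnS /=; apply/idP/idP; first exact: maxm.
  by move=> im; move/chi_intervalP: (intP _ VP); apply; [exact: x0V|exact: mV|rewrite rx0].
exists (Ordinal (chi_rank_lt (chi_word w) m)) => k; apply/idP/eqP => [kP|->]; last first.
  by rewrite /= -VE.
have x0k : x0 \in rank_seg (chi_word w) 0 k.+1 by rewrite in_rank_seg rx0.
have := def_pblock trivP kP x0k; rewrite VE => E; apply: val_inj => /=.
(* [y] and [m] are the last letters of two equal prefixes; each lies in the other, so their ranks
   agree. *)
have [y ry] := chi_rank_surj (chi_word w) (ltn_ord k).
have : m \in pblock P x0 by []; rewrite VE E in_rank_seg.
have : y \in rank_seg (chi_word w) 0 k.+1 by rewrite in_rank_seg ry leqnn.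
by rewrite -E in_rank_seg ry; lia.
Qed.

(** * Partitions with a prescribed first block *)

Section FirstBlock.
Variables (w : word) (k : nat).
Hypothesis lt_k : (k < size w)%N.

Local Notation I := (rank_seg (chi_word w) 0 k.+1).
Local Notation D := (rank_seg (chi_word w) k.+1 (size w)).
Local Notation h := (@restr_emb w D).

Lemma setC_first_block : ~: I = D.
Proof. by apply/setP => i; rewrite !inE chi_rank_lt andbT /= -leqNgt. Qed.

Lemma first_block_neq0 : I != set0.
Proof.
have [x rx] := chi_rank_surj (chi_word w) lt_k.
by apply/set0Pn; exists x; rewrite in_rank_seg rx leqnn.
Qed.

(** The images lie in [D], which is disjoint from the non-empty [I]; this makes adjoining [I]
    reversible. *)
Lemma first_block_notin (Q : {set {set 'I_(size (word_restr w D))}}) :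
  I \notin [set h @: V | V : {set _} in Q].
Proof.
have /set0Pn[x xI] := first_block_neq0; apply/imsetP => -[V _ IE].
have := xI; rewrite {1}IE => /imsetP[y _ xy].
by have := restr_embP y; rewrite -xy -setC_first_block inE xI.
Qed.

Lemma BI_add_first_block (Q : {set {set 'I_(size (word_restr w D))}}) :
  (I |: [set h @: V | V : {set _} in Q] \in BI (chi_word w)) =
  (Q \in BI (chi_word (word_restr w D))).
Proof.
rewrite !inE; congr (_ && _).
  rewrite -(imset_partition _ _ (@restr_emb_inj w D)) imset_restr_emb.
  apply/idP/idP => part.
    have := partitionD1 part (setU11 _ _).
    by rewrite setU1K ?first_block_notin // setTD setC_first_block.
  rewrite -(setUCr I) setC_first_block; apply: partitionU1 => //.
    exact: first_block_neq0.
  by rewrite -setC_first_block -setI_eq0 setICr.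
apply/forall_inP/forall_inP => H V.
  by move=> VQ; rewrite -chi_interval_seg; apply: H; rewrite setU1r // imset_f.
case/setU1P => [->|/imsetP[U UQ ->]]; first exact: chi_interval_rank_seg.
by rewrite chi_interval_seg; apply: H.
Qed.

(** A bi-interval partition containing [I] is [I] together with the image of a bi-interval partition
    of the remaining subword, and the product splits accordingly. *)
Lemma sum_first_block :
  \sum_(P in BI (chi_word w) | I \in P) \prod_(V in P) B (word_restr w V) =
  B (word_seg w 0 k.+1) * M (word_seg w k.+1 (size w)).
Proof.
rewrite moment_word big_distrr /=.
(* The inverse map deletes [I] and pulls the other blocks back along [h]. *)
rewrite (reindex_onto (fun Q : {set {set 'I_(size (word_restr w D))}} =>
                         I |: [set h @: V | V : {set _} in Q])
                      (fun P => [set h @^-1: V | V : {set _} in P :\ I])) /=.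
  apply: eq_big => [Q|Q _].
    rewrite BI_add_first_block setU11 andbT andb_idr // => _.
    rewrite setU1K ?first_block_notin // -imset_comp; apply/eqP.
    rewrite -[RHS]imset_id; apply: eq_imset => V /=; apply/setP => i.
    by rewrite inE mem_imset //; exact: restr_emb_inj.
  rewrite big_setU1 ?first_block_notin //=; congr (_ * _).
  rewrite big_imset /=; last by move=> U V _ _; exact: (imset_inj (@restr_emb_inj w D)).
  by apply: eq_bigr => V _; rewrite word_restr_restr.
move=> P /andP[]; rewrite inE => /andP[partP _] IP.
rewrite -imset_comp -[RHS](setD1K IP); congr (_ |: _).
rewrite -[RHS]imset_id; apply: eq_in_imset => V /setD1P[VI VP] /=.
have /trivIsetP triv := partition_trivIset partP.
apply/setP => i; apply/imsetP/idP => [[j]|iV]; first by rewrite inE => jV ->.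
(* A block other than [I] is disjoint from [I], hence lies in the image of [h]. *)
have /restr_emb_surj[j ij] : i \in D.
  rewrite -setC_first_block inE; apply/negP => iI.
  by have /disjointFr/(_ iV) := triv _ _ VP IP VI; rewrite iI.
by exists j => //; rewrite inE -ij.
Qed.

End FirstBlock.

(** Partitions are sorted by the length [k.+1] of their first block, which [BI_first_block] shows to
    be unique. *)
Lemma moment_word_rec w : (0 < size w)%N ->
  M w = \sum_(k < size w) B (word_seg w 0 k.+1) * M (word_seg w k.+1 (size w)).
Proof.
move=> n0; rewrite moment_word.
under [RHS]eq_bigr => k _ do rewrite -(sum_first_block (ltn_ord k)).
rewrite [RHS](exchange_big_dep (mem (BI (chi_word w)))) /=; last by move=> k P _ /andP[].
apply: eq_bigr => P PB; have [k0 k0P] := BI_first_block n0 PB.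
by rewrite (big_pred1 k0) // => k; rewrite /= k0P PB.
Qed.

End Moments.

(** * Alternating words and factorizations *)

Implicit Types u v : word.

(* Is the letter of (zero-based) rank i in the chi-order starred? *)
Definition star (w : word) i : bool := nth false [seq x.2 | x <- chi_arrange w] i.

Lemma star_seg w a b i : (b <= size w)%N -> (i < b - a)%N ->
  star (word_seg w a b) i = star w (a + i)%N.
Proof.
by move=> bw ib; rewrite /star chi_arrange_seg map_take map_drop nth_take ?nth_drop.
Qed.

(** The shape l...lr...r required in [Wset]; as a pairwise condition it passes to the factors of a
    concatenation. *)
Definition lr_sorted (v : word) : bool :=
  pairwise (fun x y : letter => (x.1 == lface) || (y.1 == rface)) v.

Lemma lr_sorted_cat v1 v2 :
  all (fun x => x.1 == lface) v1 -> all (fun x => x.1 == rface) v2 ->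
  lr_sorted (v1 ++ v2).
Proof.
rewrite /lr_sorted; elim: v1 => [_|x v1 IH] /=.
  elim: v2 => //= x v2 IH /andP[_ r2]; rewrite IH // andbT.
  by apply: sub_all r2 => y /= ->; rewrite orbT.
move=> /andP[/eqP xl l1 r2]; rewrite IH // andbT.
by apply/allP => y _; rewrite xl.
Qed.

Lemma lr_sorted_chi_arrange w : lr_sorted (chi_arrange w).
Proof.
rewrite /chi_arrange map_cat; apply: lr_sorted_cat; rewrite all_map.
  by apply/allP => i; rewrite mem_filter => /andP[].
by apply/allP => i; rewrite mem_rev mem_filter => /andP[].
Qed.

Lemma lr_sorted_split u : lr_sorted u ->
  exists2 k, (k <= size u)%N &
    u = [seq (lface, s) | s <- take k [seq x.2 | x <- u]]
        ++ [seq (rface, s) | s <- drop k [seq x.2 | x <- u]].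
Proof.
rewrite /lr_sorted; elim: u => [|[x s] u IH] /=; first by exists 0.
case/andP => xu /IH[k ku ukE].
case: x xu => xu; first by exists k.+1; rewrite //= -ukE.
exists 0 => //=; congr (_ :: _).
by elim: u xu {IH ku ukE} => //= -[y t] u IH /andP[/eqP/= -> /IH <-].
Qed.

(** What remains of [Wset] without the initial star and without the l/r shape, which every
    [chi_arrange w] has. *)
Definition alt (u : word) : bool :=
  [&& u != [::], ~~ odd (size u) & sorted (fun s t => s != t) [seq x.2 | x <- u]].

Definition head_star u := head false [seq x.2 | x <- u].
Definition last_star u := last false [seq x.2 | x <- u].

Lemma WsetE e u : Wset e u <-> [/\ lr_sorted u, alt u & head_star u = e].
Proof.
split=> [[m [k [om [m0 km ome srt ->]]]]|].
  have E : [seq x.2 | x <- [seq (lface, s) | s <- take k om]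
             ++ [seq (rface, s) | s <- drop k om]] = om :> seq bool.
    by rewrite map_cat -!map_comp !map_id cat_take_drop.
  have sz : size ([seq (lface, s) | s <- take k om]
             ++ [seq (rface, s) | s <- drop k om]) = (2 * m)%N.
    by rewrite -(size_map snd) E size_tuple.
  rewrite /alt /head_star E srt -size_eq0 sz; split.
  - by apply: lr_sorted_cat; rewrite all_map; apply/allP.
  - by rewrite mul2n odd_double double_eq0 /= andbT -lt0n.
  - by move: ome; case: (val om) => //= ? ? [].
case=> /lr_sorted_split[k ku uE] /and3P[u0 ev srt] he.
have sz : size [seq x.2 | x <- u] == (2 * (size u)./2)%N.
  by rewrite size_map mul2n even_halfK.
exists (size u)./2, k, (Tuple sz); split=> //.
- by move: u0 ev; case: (u) => [|? [|? ?]].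
- by lia.
- by move: u0 he; rewrite /head_star /=; case: (u) => //= ? ? _ ->.
Qed.

Lemma alternatingE w : alternating w <-> alt (chi_arrange w).
Proof.
split=> [[]/WsetE[]//|a].
case E: (head_star (chi_arrange w)); [right|left]; apply/WsetE; split=> //;
  exact: lr_sorted_chi_arrange.
Qed.

(** The star flips at each of the [size u - 1] steps, an odd number. *)
Lemma last_star_alt u : alt u -> last_star u = ~~ head_star u.
Proof.
rewrite /alt /last_star /head_star -(size_map snd) -size_eq0 -(size_map snd u).
case: [seq x.2 | x <- u] => //= b s /andP[]; rewrite negbK.
have : path (fun s t => s != t) b s -> last b s = b (+) odd (size s).
  elim: s b => [|c s IH] b /=; first by rewrite addbF.
  by case/andP => bc /IH->; case: b c bc (odd _) => [] [] // _ [].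
by move=> H od /H ->; rewrite od addbT.
Qed.

(** * Factorizations and the cuts between equal stars *)

Definition junction u v := last_star u == head_star v.

(** Form of [canonical_factorization] without the indices [js]: each is the head star of its factor,
    and their alternation becomes [junction]. *)
Definition factorization v (us : seq word) : bool :=
  [&& us != [::], v == flatten us, all alt us & sorted junction us].

(* An alternating word of even length in W_j ends with the star opposite to j. *)
Lemma sorted_junction us : all alt us ->
  sorted junction us = sorted (fun j j' => j != j') [seq head_star u | u <- us].
Proof.
rewrite sorted_map; case: us => //= u us; elim: us u => //= v us IH u.
case/and3P => au av aus; rewrite IH /= ?av //; congr (_ && _).
by rewrite /junction last_star_alt //; case: head_star; case: head_star.
Qed.

Lemma lr_sorted_flatten us u : lr_sorted (flatten us) -> u \in us -> lr_sorted u.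
Proof.
rewrite /lr_sorted; elim: us => //= v us IH; rewrite pairwise_cat => /and3P[_ vs uss].
by rewrite inE => /orP[/eqP->|/IH]; last apply.
Qed.

Lemma canonical_factorizationE w us :
  canonical_factorization w us <-> factorization (chi_arrange w) us.
Proof.
split=> [[us1 wE [js [szjs WW srt]]]|/and4P[us0 /eqP wE aus srt]].
  have aus : all alt us by apply/(all_nthP [::]) => i /WW/WsetE[].
  apply/and4P; split=> //; [by case: (us) us1|by apply/eqP|].
  rewrite sorted_junction //; suff -> : [seq head_star u | u <- us] = js by [].
  apply: (@eq_from_nth _ false) => [|i]; rewrite size_map // => ius.
  by rewrite (nth_map [::]) //; case/WsetE: (WW i ius).
split=> //; first by case: (us) us0.
exists [seq head_star u | u <- us]; split; [exact: size_map| |by rewrite -sorted_junction].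
move=> i ius; apply/WsetE; rewrite (nth_map [::]) //; split=> //.
  by apply: (@lr_sorted_flatten us); rewrite -?wE ?lr_sorted_chi_arrange ?mem_nth.
by move/(all_nthP [::]): aus; apply.
Qed.

Lemma last_star_flatten us : all alt us -> us != [::] ->
  last_star (flatten us) = last_star (last [::] us).
Proof.
case/lastP: us => // us u; rewrite all_rcons => /andP[/and3P[u0 _ _] _] _.
rewrite last_rcons flatten_rcons /last_star map_cat last_cat.
by case: u u0.
Qed.

Lemma head_star_flatten us : all alt us -> us != [::] ->
  head_star (flatten us) = head_star (head [::] us).
Proof. by case: us => [|[|x u] us]. Qed.

(** The only new junction is where [us1] meets [us2]; since factors are non-empty, its two letters
    are the last of [v1] and the first of [v2]. *)
Lemma factorization_cat v1 v2 us1 us2 :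
  last_star v1 = head_star v2 -> factorization v1 us1 -> factorization v2 us2 ->
  factorization (v1 ++ v2) (us1 ++ us2).
Proof.
move=> junc /and4P[n1 /eqP E1 a1 s1] /and4P[n2 /eqP E2 a2 s2].
apply/and4P; split; rewrite ?all_cat ?a1 //; first by case: (us1) n1.
  by rewrite flatten_cat E1 E2.
move: junc; rewrite E1 E2 last_star_flatten // head_star_flatten // => /eqP.
case: us1 n1 s1 {E1 a1} => // u us1 _; case: us2 n2 s2 {E2 a2} => // u' us2 _ /=.
by rewrite cat_path /= -/(junction _ _) => -> -> ->.
Qed.

Lemma factorization_alt v : alt v -> factorization v [:: v].
Proof. by move=> av; rewrite /factorization /= cats0 eqxx av. Qed.

Lemma odd_size_factorization v us : factorization v us -> ~~ odd (size v).
Proof.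
case/and4P => _ /eqP-> aus _; elim: us aus => //= u us IH /andP[/and3P[_ ou _] /IH].
by rewrite size_cat oddD (negbTE ou).
Qed.

(** Stars differ at consecutive letters of an alternating factor, so a cut between equal stars must
    be a boundary between two factors. *)
Lemma factorization_cut v us c : (0 < c < size v)%N ->
  nth false [seq x.2 | x <- v] c.-1 = nth false [seq x.2 | x <- v] c ->
  factorization v us ->
  exists us1 us2, [/\ us = us1 ++ us2, factorization (take c v) us1 &
                      factorization (drop c v) us2].
Proof.
move=> cv cc /and4P[_ /eqP vE]; move: cv cc; rewrite {}vE.
elim: us c => [|u us IH] c /=; first by rewrite ltn0 andbF.
rewrite map_cat size_cat => cv cc /andP[au aus] srt.
have srt' : sorted junction us := path_sorted srt.
case: (ltngtP c (size u)) => cu.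
(* A cut strictly inside [u] contradicts the alternation of [u]. *)
- have /and3P[_ _ /(sortedP false)/(_ c.-1)] := au.
  rewrite size_map prednK; last by lia.
  move/(_ cu); move: cc; rewrite !nth_cat size_map cu (_ : c.-1 < size u)%N; last by lia.
  by move=> ->; rewrite eqxx.
- have [||us1 [us2 [usE f1 f2]]] := IH (c - size u)%N _ _ aus srt'.
  + by lia.
  + move: cc; rewrite !nth_cat size_map (_ : (c.-1 < size u)%N = false); last by lia.
    rewrite ltnNge (ltnW cu) /= (_ : (c.-1 - size u)%N = (c - size u).-1) //; lia.
  exists (u :: us1), us2; rewrite take_cat drop_cat ltnNge (ltnW cu) /=; split=> //.
    by rewrite usE.
  have /and4P[_ /eqP -> a1 _] := f1.
  apply/and4P; split=> //=; first by rewrite au.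
  by move: srt; rewrite usE cat_path => /andP[].
- exists [:: u], us; rewrite cu take_size_cat // drop_size_cat //; split=> //.
    exact: factorization_alt.
  (* [us] is non-empty because the cut lies strictly before the end of the word. *)
  apply/and4P; split=> //; apply: contraTneq cv => ->; rewrite /= cu; lia.
Qed.

(** * Eta-diagonality and factorization of moments *)

Section EtaDiagonal.
Variables (R : realType) (mu : {scalar ncpoly R}).
Hypothesis mu1 : mu 1 = 1.

Local Notation M w := (mu (Zword R w)).
Local Notation B w := (bcumulant_word mu w).

Definition factorizing : Prop :=
  (forall w, odd (size w) -> M w = 0) /\
  (forall w c, (0 < c < size w)%N -> star w c.-1 = star w c ->
     M w = M (word_seg w 0 c) * M (word_seg w c (size w))).

Lemma alternatingP w : alternating w <->
  [/\ (0 < size w)%N, ~~ odd (size w)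
    & forall c, (0 < c < size w)%N -> star w c.-1 != star w c].
Proof.
rewrite alternatingE /alt -size_eq0 size_chi_arrange lt0n; split.
  case/and3P=> w0 ew /(sortedP false) H; split=> // -[//|c] /andP[_ cw].
  by apply: H; rewrite size_map size_chi_arrange.
case=> w0 ew H; apply/and3P; split=> //; apply/(sortedP false) => c.
by rewrite size_map size_chi_arrange => cw; apply: (H c.+1).
Qed.

Lemma not_alternatingP w : (0 < size w)%N -> ~ alternating w ->
  odd (size w) \/ exists2 c, (0 < c < size w)%N & star w c.-1 = star w c.
Proof.
move=> w0 nalt; have [od|ev] := boolP (odd (size w)); first by left.
right; have [/existsP[c /andP[c0 /eqP cc]]|no] :=
  boolP [exists c : 'I_(size w), (0 < c)%N && (star w c.-1 == star w c)].
  by exists c; rewrite // c0 ltn_ord.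
case: nalt; apply/alternatingP; split=> // c /andP[c0 cw].
by move/existsPn: no => /(_ (Ordinal cw)); rewrite c0.
Qed.

Lemma word_seg_nil w a : (a <= size w)%N -> word_seg w a a = [::].
Proof. by move=> aw; apply: size0nil; rewrite size_seg // subnn. Qed.

Lemma star_seg_prefix w c k : (k <= size w)%N -> (c < k)%N ->
  star (word_seg w 0 k) c = star w c.
Proof. by move=> kw ck; rewrite star_seg ?subn0. Qed.

Lemma star_seg_suffix w c k : (k <= c < size w)%N ->
  star (word_seg w k (size w)) (c - k) = star w c.
Proof.
case/andP=> kc cw; rewrite star_seg //; last exact: ltn_sub2r (leq_ltn_trans kc cw) cw.
by rewrite subnKC.
Qed.

(** Isolates the one-block term [k = size w], whose remaining factor is the moment of the empty
    word. *)
Lemma moment_word_rec_last w : (0 < size w)%N ->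
  M w = \sum_(1 <= k < size w) B (word_seg w 0 k) * M (word_seg w k (size w)) + B w.
Proof.
move=> n0; rewrite (moment_word_rec mu1 n0).
rewrite -(big_mkord predT (fun k => B (word_seg w 0 k.+1) * M (word_seg w k.+1 (size w)))).
rewrite -(prednK n0) big_nat_recr //= prednK // word_seg_full word_seg_nil //.
by rewrite moment_word_nil // mulr1 [in RHS]big_add1.
Qed.

(* When no block crosses the cut c, the terms k <= c of the recursion for w are
   those of the recursion for its first c letters times a common factor. *)
Lemma moment_word_split w c : (0 < c < size w)%N ->
  (forall k, (0 < k < c)%N ->
     M (word_seg w k (size w)) = M (word_seg w k c) * M (word_seg w c (size w))) ->
  (forall k, (c < k < size w)%N -> B (word_seg w 0 k) = 0) ->
  M w = M (word_seg w 0 c) * M (word_seg w c (size w)) + B w.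
Proof.
move=> /andP[c0 cw] splt B0; rewrite moment_word_rec_last; last by lia.
congr (_ + _); have szc : size (word_seg w 0 c) = c by rewrite size_seg ?subn0 // ltnW.
rewrite (@moment_word_rec_last (word_seg w 0 c)) szc //.
rewrite (big_cat_nat (n := c)) //=; last exact: ltnW.
rewrite mulrDl mulr_suml; congr (_ + _).
  apply: eq_big_nat => k /andP[k0 kc].
  by rewrite splt ?k0 // mulrA !word_seg_seg ?add0n // ltnW.
(* The term [k = c] is the one-block term of the prefix; the later ones cross the cut. *)
rewrite big_ltn // big_nat big1 ?addr0 // => k ck.
by rewrite B0 ?mul0r.
Qed.

(** Both parts go by induction on the length. An odd length splits into an odd and an even part, so
    each term has a vanishing cumulant or a vanishing shorter moment; at a cut, [moment_word_split]
    applies with [B w = 0]. *)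
Lemma eta_diagonal_factorizing : eta_diagonal mu -> factorizing.
Proof.
move=> eta; have B0 w : (0 < size w)%N -> ~ alternating w -> B w = 0.
  by rewrite lt0n size_eq0; apply: eta.
split=> w.
  have [n] := ubnP (size w); elim: n w => // n IH w wn ow.
  have w0 : (0 < size w)%N by case: (size w) ow.
  rewrite moment_word_rec_last // (B0 w) //; last by case/alternatingP; rewrite ow.
  rewrite addr0 big_nat big1 // => k /andP[k0 kw].
  have szk : size (word_seg w 0 k) = k by rewrite size_seg ?subn0 // ltnW.
  have [ok|ek] := boolP (odd k).
    by rewrite B0 ?szk // ?mul0r // => /alternatingP[_]; rewrite szk ok.
  by rewrite IH ?mulr0 // size_seg //; lia.
have [n] := ubnP (size w); elim: n w => // n IH w wn c cw cc.
rewrite {1}(@moment_word_split w c) //.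
- rewrite (B0 w) ?addr0 //; first by lia.
  by case/alternatingP => _ _ /(_ c cw); rewrite cc eqxx.
(* By induction the suffix from [k] splits at the same cut, now at position [c - k]. *)
- move=> k kc; have szk : size (word_seg w k (size w)) = (size w - k)%N by rewrite size_seg.
  rewrite (IH (word_seg w k (size w)) _ (c - k)%N) ?szk.
  + by rewrite !word_seg_seg ?addn0 ?subnKC //; lia.
  + by lia.
  + by lia.
  + by rewrite (_ : (c - k).-1 = c.-1 - k)%N ?star_seg_suffix //; lia.
(* A prefix ending beyond [c] contains the cut, so it is not alternating. *)
move=> k ck; have szk : size (word_seg w 0 k) = k by rewrite size_seg ?subn0 //; lia.
rewrite B0 ?szk //; first by lia.
case/alternatingP => _ _ /(_ c); rewrite szk !star_seg_prefix ?cc ?eqxx //; lia.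
Qed.

(** The same recursion read backwards, by induction on the length: for a non-alternating word the
    terms other than [B w] already add up to [M w]. *)
Lemma factorizing_eta_diagonal : factorizing -> eta_diagonal mu.
Proof.
case=> Modd Msplit w; rewrite -size_eq0 -lt0n.
have [n] := ubnP (size w); elim: n w => // n IH w wn w0 nalt.
have [ow|[c cw cc]] := not_alternatingP w0 nalt.
  have := Modd w ow; rewrite moment_word_rec_last // big_nat big1 ?add0r //.
  move=> k /andP[k0 kw].
  have szk : size (word_seg w 0 k) = k by rewrite size_seg ?subn0 // ltnW.
  have [ok|ek] := boolP (odd k).
    by rewrite IH ?szk ?mul0r //; [lia|case/alternatingP=> _; rewrite szk ok].
  by rewrite Modd ?mulr0 // size_seg //; lia.
have := Msplit w c cw cc; rewrite {1}(moment_word_split cw).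
- by move/(canRL (addKr _)); rewrite addNr.
- move=> k kc; have szk : size (word_seg w k (size w)) = (size w - k)%N by rewrite size_seg.
  rewrite (Msplit (word_seg w k (size w)) (c - k)%N) ?szk.
  + by rewrite !word_seg_seg ?addn0 ?subnKC //; lia.
  + by lia.
  + by rewrite (_ : (c - k).-1 = c.-1 - k)%N ?star_seg_suffix //; lia.
move=> k ck; have szk : size (word_seg w 0 k) = k by rewrite size_seg ?subn0 //; lia.
rewrite IH ?szk //; try lia.
case/alternatingP => _ _ /(_ c); rewrite szk !star_seg_prefix ?cc ?eqxx //; lia.
Qed.

(** * Moments along a factorization *)

Fixpoint seg_moments (w : word) a (us : seq word) : complex R :=
  if us is u :: us' then
    M (word_seg w a (a + size u)%N) * seg_moments w (a + size u)%N us'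
  else 1.

(** The starting rank carried by [seg_moments] replaces the partial sums in [factor_block], which
    suits induction on [us]. *)
Lemma prod_factor_blocks w us :
  \prod_(i < size us) M (word_restr w (factor_block w us i)) = seg_moments w 0 us.
Proof.
pose st (vs : seq word) i := (\sum_(j < i) size (nth [::] vs j))%N.
suff gen a : \prod_(i < size us)
    M (word_seg w (a + st us i)%N (a + st us i + size (nth [::] us i))%N) =
    seg_moments w a us by rewrite -gen.
elim: us a => [|u us IH] a /=; first by rewrite big_ord0.
rewrite big_ord_recl /= {1 2}/st big_ord0 addn0 -IH; congr (_ * _).
by apply: eq_bigr => i _; rewrite /st big_ord_recl /= addnA.
Qed.

Lemma seg_moments_cat w a us1 us2 :
  seg_moments w a (us1 ++ us2) =
  seg_moments w a us1 * seg_moments w (a + size (flatten us1))%N us2.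
Proof.
elim: us1 a => [|u us1 IH] a /=; first by rewrite addn0 mul1r.
by rewrite IH size_cat addnA mulrA.
Qed.

Lemma seg_moments_seg w a b c us : (a + (c + size (flatten us)) <= b)%N ->
  seg_moments (word_seg w a b) c us = seg_moments w (a + c)%N us.
Proof.
elim: us c => //= u us IH c; rewrite size_cat => le_b.
by rewrite word_seg_seg ?IH ?addnA //; lia.
Qed.

Lemma chi_arrange_prefix w c : chi_arrange (word_seg w 0 c) = take c (chi_arrange w).
Proof. by rewrite chi_arrange_seg subn0 drop0. Qed.

Lemma chi_arrange_suffix w c :
  chi_arrange (word_seg w c (size w)) = drop c (chi_arrange w).
Proof.
by rewrite chi_arrange_seg take_oversize // size_drop size_chi_arrange.
Qed.

Lemma mixed_alternating_cut w c : (0 < c < size w)%N -> star w c.-1 = star w c ->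
  mixed_alternating w ->
  mixed_alternating (word_seg w 0 c) /\ mixed_alternating (word_seg w c (size w)).
Proof.
move=> cw cc [us /canonical_factorizationE fus].
have [|us1 [us2 [_ f1 f2]]] := factorization_cut _ cc fus; first by rewrite size_chi_arrange.
split; [exists us1|exists us2]; apply/canonical_factorizationE.
  by rewrite chi_arrange_prefix.
by rewrite chi_arrange_suffix.
Qed.

Lemma canonical_factorization_cat w c us1 us2 :
  (0 < c < size w)%N -> star w c.-1 = star w c ->
  canonical_factorization (word_seg w 0 c) us1 ->
  canonical_factorization (word_seg w c (size w)) us2 ->
  canonical_factorization w (us1 ++ us2).
Proof.
move=> cw cc /canonical_factorizationE f1 /canonical_factorizationE f2.
apply/canonical_factorizationE; rewrite -(cat_take_drop c (chi_arrange w)).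
rewrite -chi_arrange_prefix -chi_arrange_suffix; apply: factorization_cat => //.
rewrite /last_star /head_star chi_arrange_prefix chi_arrange_suffix.
move: cc; rewrite /star map_take map_drop.
have : (0 < c < size [seq x.2 | x <- chi_arrange w])%N.
  by rewrite size_map size_chi_arrange.
move: [seq x.2 | x <- chi_arrange w] => s cs cc.
rewrite -nth_last size_takel; last by lia.
by rewrite nth_take; [rewrite cc -nth0 nth_drop addn0|lia].
Qed.

Lemma even_mixed_alternating w : mixed_alternating w -> ~~ odd (size w).
Proof.
by case=> us /canonical_factorizationE/odd_size_factorization; rewrite size_chi_arrange.
Qed.

Lemma alternating_mixed w : alternating w -> mixed_alternating w.
Proof.
move=> /alternatingE aw; exists [:: chi_arrange w].
by apply/canonical_factorizationE; apply: factorization_alt.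
Qed.

Lemma canonical_factorization_size w us : canonical_factorization w us ->
  size (flatten us) = size w.
Proof. by case=> _ <- _; rewrite size_chi_arrange. Qed.

(** Exhibits the boundary after the first factor as a cut at which [factorizing] splits the moment,
    leaving a shorter factorization. *)
Lemma canonical_factorization_cons w u us : us != [::] ->
  canonical_factorization w (u :: us) ->
  [/\ (0 < size u < size w)%N, star w (size u).-1 = star w (size u) &
      canonical_factorization (word_seg w (size u) (size w)) us].
Proof.
case: us => // v us _ /canonical_factorizationE/and4P[_ /eqP wE].
move=> /andP[au avus] /andP[/eqP juv srt].
have u0 : (0 < size u)%N by case/and3P: au; case: (u).
have v0 : (0 < size v)%N by case/andP: avus => /and3P[]; case: (v).
have szw : size w = (size u + (size v + size (flatten us)))%N.
  by rewrite -size_chi_arrange wE !size_cat.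
split; first by rewrite szw; lia.
  rewrite /star wE /= map_cat !nth_cat size_map ltnn subnn.
  rewrite (_ : (size u).-1 < size u)%N; last by lia.
  move: juv; rewrite /last_star /head_star -nth_last -nth0 size_map => ->.
  by rewrite map_cat nth_cat size_map v0.
apply/canonical_factorizationE; rewrite chi_arrange_suffix wE /= drop_size_cat //.
by apply/and4P.
Qed.

(** A word that is not mixed alternating is odd or has a cut; at the cut the halves cannot both be
    mixed alternating, else their factorizations would concatenate. For a mixed alternating word,
    factors are split off one by one. *)
Lemma factorizing_moments : factorizing ->
  (forall w, w != [::] -> ~ mixed_alternating w -> M w = 0) /\
  (forall w us, canonical_factorization w us -> M w = seg_moments w 0 us).
Proof.
case=> Modd Msplit; split=> w.
  rewrite -size_eq0 -lt0n.
  have [n] := ubnP (size w); elim: n w => // n IH w wn w0 nmix.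
  have [|/Modd //|[c cw cc]] := not_alternatingP w0.
    by move/alternating_mixed.
  have /andP[c0 cw'] := cw; rewrite (Msplit w c cw cc).
  have sz1 : size (word_seg w 0 c) = c by rewrite size_seg ?subn0 //; lia.
  have sz2 : size (word_seg w c (size w)) = (size w - c)%N by rewrite size_seg.
  (* If neither moment vanished, each half would be mixed alternating up to double negation, which
     suffices since the goal is [False]. *)
  apply/eqP; rewrite mulf_eq0; apply: contraT => /norP[/eqP M1 /eqP M2]; exfalso.
  have nn1 : ~ ~ mixed_alternating (word_seg w 0 c).
    by move=> nm; apply: M1; apply: IH => //; rewrite sz1 //; apply: leq_trans cw' wn.
  have nn2 : ~ ~ mixed_alternating (word_seg w c (size w)).
    by move=> nm; apply: M2; apply: IH => //; rewrite sz2 ?subn_gt0 //; lia.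
  apply: nn1 => -[us1 f1]; apply: nn2 => -[us2 f2]; apply: nmix.
  by exists (us1 ++ us2); apply: canonical_factorization_cat f2.
move=> us; elim: us w => [|u us IH] w fus; first by case: fus.
have := canonical_factorization_size fus; rewrite /= size_cat => szw.
have [us0|us0] := eqVneq us [::].
  move: szw; rewrite us0 /= addn0 => szw.
  by rewrite mulr1 add0n szw word_seg_full.
have [uw cc fus'] := canonical_factorization_cons us0 fus.
rewrite (Msplit _ _ uw cc) (IH _ fus') /= add0n; congr (_ * _).
by rewrite seg_moments_seg ?addn0 // add0n szw.
Qed.

(** At a cut, [w] is mixed alternating exactly when both halves are: either both sides vanish or the
    products of moments concatenate. *)
Lemma moments_factorizing :
  (forall w, w != [::] -> ~ mixed_alternating w -> M w = 0) ->
  (forall w us, w != [::] -> canonical_factorization w us -> M w = seg_moments w 0 us) ->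
  factorizing.
Proof.
move=> M0 Mus; split=> [w ow|w c cw cc].
  by apply: M0 => [|/even_mixed_alternating]; [case: w ow|rewrite ow].
have w0 : w != [::] by case: (w) cw; rewrite ?andbF.
have /andP[c0 cw'] := cw.
have sz1 : size (word_seg w 0 c) = c by rewrite size_seg ?subn0 //; lia.
have sz2 : size (word_seg w c (size w)) = (size w - c)%N by rewrite size_seg.
have n1 : word_seg w 0 c != [::] by rewrite -size_eq0 sz1 -lt0n.
have n2 : word_seg w c (size w) != [::] by rewrite -size_eq0 sz2 -lt0n subn_gt0.
(* The goal is now a boolean, so a case distinction on whether a half is mixed alternating needs no
   axiom. *)
apply/eqP; apply: (@classic_EM (mixed_alternating (word_seg w 0 c))).
case=> [[us1 f1]|nm1]; last first.
  rewrite (M0 w) // ?(M0 _ n1 nm1) ?mul0r // => mix.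
  by case: (mixed_alternating_cut cw cc mix).
apply: (@classic_EM (mixed_alternating (word_seg w c (size w)))).
case=> [[us2 f2]|nm2]; last first.
  rewrite (M0 w) // ?(M0 _ n2 nm2) ?mulr0 // => mix.
  by case: (mixed_alternating_cut cw cc mix).
have s1 := canonical_factorization_size f1; have s2 := canonical_factorization_size f2.
rewrite (Mus _ _ n1 f1) (Mus _ _ n2 f2).
rewrite (Mus _ _ w0 (canonical_factorization_cat cw cc f1 f2)) seg_moments_cat.
by rewrite !seg_moments_seg ?addn0 ?s1 ?s2 ?sz1 ?sz2 ?add0n //; lia.
Qed.

End EtaDiagonal.

Theorem theorem4p8 (R : realType) (mu : {scalar ncpoly R}) (mu1 : mu 1 = 1) :
  eta_diagonal mu <->
  (forall w : word, w != [::] -> ~ mixed_alternating w -> mu (Zword R w) = 0) /\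
  (forall (w : word) (us : seq word), w != [::] ->
     canonical_factorization w us ->
     mu (Zword R w) =
     \prod_(i < size us) mu (Zword R (word_restr w (factor_block w us i)))).
Proof.
split=> [/(eta_diagonal_factorizing mu1)/factorizing_moments[M0 Mus]|[M0 Mus]].
  by split=> // w us _ /Mus ->; rewrite prod_factor_blocks.
apply: factorizing_eta_diagonal => //; apply: moments_factorizing => // w us w0 fus.
by rewrite -prod_factor_blocks; apply: Mus.
Qed.
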